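(* Let $I$ be an HN ideal of $A=k[x_1,x_2,x_3]$ and let $m(I)\in\mathbb{N}^3$ be its associated integer vector. Then the following conditions are equivalent: (i) $I$ is prime; (ii) $I=\mathfrak{p}_{m(I)}$; (iii) $\gcd(m(I))=1$.
   Context: $k$ is a field, $A=k[x_1,x_2,x_3]$ is the polynomial ring in three variables, $\mathbb{N}$ denotes the positive integers. An HN (Herzog-Northcott) ideal of $A$ is an ideal $I=(v_1,v_2,D)$ with $v_1=x_1^{c_1}-x_2^{b_2}x_3^{a_3}$, $v_2=x_2^{c_2}-x_1^{a_1}x_3^{b_3}$, $D=x_3^{c_3}-x_1^{b_1}x_2^{a_2}$, where $a=(a_1,a_2,a_3),b=(b_1,b_2,b_3)\in\mathbb{N}^3$ and $c=(c_1,c_2,c_3)=a+b$. The integer vector associated to $I$ is $m(I)=(m_1(I),m_2(I),m_3(I))$, where $m_i(I)=\operatorname{length}(A/(x_iA+I))$ for $i=1,2,3$ (each $x_iA+I$ is primary to the maximal ideal $(x_1,x_2,x_3)$, so these lengths are finite). $\gcd(m(I))$ is the greatest common divisor of its three entries. For $n=(n_1,n_2,n_3)\in\mathbb{N}^3$, the Herzog ideal $\mathfrak{p}_n$ is the kernel of the $k$-algebra homomorphism $A\to k[t]$ with $x_i\mapsto t^{n_i}$, $i=1,2,3$ (the gcd of $n$ is not required to be $1$). *)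

(* Defs.v *)
From HB Require Import structures.
From mathcomp Require Import all_boot all_order all_algebra.
From mathcomp Require Import boolp mpoly.

Set Implicit Arguments.
Unset Strict Implicit.
Unset Printing Implicit Defensive.

Import GRing.Theory.
Import Quotient.

Local Open Scope ring_scope.
Local Open Scope quotient_scope.

(* The library's [submodClosed] does not inherit from [zmodClosed], which
   [{quot _}] requires, so a submodule is first repackaged as a [zmodClosed]. *)
Section QuotientModule.
Variables (R : pzRingType) (V : lmodType R) (W : submodClosed V).

Definition submod_pred : {pred V} := fun v => v \in W.

Lemma submod_pred_zmod : zmod_closed submod_pred.
Proof.
split=> [|u v Wu Wv]; rewrite /submod_pred unfold_in; first exact: rpred0.
by rewrite -scaleN1r rpredD // rpredZ.
Qed.

HB.instance Definition _ :=
  GRing.isZmodClosed.Build V submod_pred submod_pred_zmod.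

Definition quot_mod : Type := {quot submod_pred}.

HB.instance Definition _ : EqQuotient V (equiv submod_pred) quot_mod :=
  EqQuotient.on quot_mod.
HB.instance Definition _ := ZmodQuotient.on quot_mod.

Definition quot_scale (a : R) (x : quot_mod) : quot_mod := \pi_quot_mod (a *: repr x).

Lemma pi_scale a (v : V) : \pi_quot_mod (a *: v) = quot_scale a (\pi_quot_mod v).
Proof.
apply/eqP; rewrite -idealrBE -scalerBr.
have : v - repr (\pi_quot_mod v) \in submod_pred by rewrite idealrBE reprK.
exact: rpredZ.
Qed.

Lemma quot_scaleA a b x :
  quot_scale a (quot_scale b x) = quot_scale (a * b) x.
Proof. by rewrite -[x]reprK -!pi_scale scalerA reprK. Qed.

Lemma quot_scale1 : left_id 1 quot_scale.
Proof. by move=> x; rewrite -[x]reprK -pi_scale scale1r. Qed.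

Lemma quot_scaleDr : right_distributive quot_scale +%R.
Proof.
move=> a x y; rewrite -[x]reprK -[y]reprK.
by rewrite -raddfD -!pi_scale -raddfD scalerDr.
Qed.

Lemma quot_scaleDl x : {morph quot_scale^~ x : a b / a + b}.
Proof. by move=> a b; rewrite -[x]reprK -!pi_scale -raddfD scalerDl. Qed.

HB.instance Definition _ := GRing.Zmodule_isLmodule.Build R quot_mod
  quot_scaleA quot_scale1 quot_scaleDr quot_scaleDl.
End QuotientModule.

Section Length.
Variables (R : pzRingType) (M : lmodType R).

Definition submod_chain (n : nat) : Prop :=
  exists C : 'I_n.+1 -> submodClosed M, forall i j : 'I_n.+1, (i < j)%N ->
    {subset C i <= C j} /\ ~ {subset C j <= C i}.

Definition has_length (n : nat) : Prop :=
  submod_chain n /\ forall p, submod_chain p -> (p <= n)%N.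

(* Modules of infinite length get the junk value 0. *)
Definition mod_length : nat :=
  if pselect (exists n, has_length n) is left h then projT1 (cid h) else 0%N.
End Length.
Arguments mod_length {R} M.

(* Ideals are the submodules of the regular module; the unit ideal is allowed. *)
Notation ideal R := (submodClosed R^o).

Section Ideals.
Variable R : comNzRingType.

Definition gen_ideal (s : seq R) : {pred R^o} :=
  fun p => `[< exists g : 'I_(size s) -> R, p = \sum_i g i * s`_i >].

Lemma gen_ideal_submod s : submod_closed (gen_ideal s).
Proof.
split; first by apply/asboolP; exists (fun=> 0); rewrite big1 // => i; rewrite mul0r.
move=> a u v /asboolP[g ->] /asboolP[h ->]; apply/asboolP.
exists (fun i => a * g i + h i); rewrite scaler_sumr -big_split /=.
by apply: eq_bigr => i _; rewrite mulrDl -mulrA.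
Qed.

HB.instance Definition _ s :=
  GRing.isSubmodClosed.Build R R^o (gen_ideal s) (gen_ideal_submod s).

(* [idealr_closed] includes properness. *)
Definition prime_ideal (P : {pred R}) : Prop :=
  idealr_closed P /\ prime_idealr_closed P.

Section AddPrincipal.
Variables (x : R) (I : ideal R).

(* The ideal x R + I. *)
Definition add_principal : {pred R^o} :=
  fun p => `[< exists g, p - x * g \in I >].

Lemma add_principal_submod : submod_closed add_principal.
Proof.
split; first by apply/asboolP; exists 0; rewrite mulr0 subr0 rpred0.
move=> a u v /asboolP[g Ig] /asboolP[h Ih]; apply/asboolP; exists (a * g + h).
have -> : a *: u + v - x * (a * g + h) =
          a *: (u - x * g : R^o) + (v - x * h : R^o).
  by rewrite scalerBr mulrDr opprD addrACA [x * _]mulrCA.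
by rewrite rpredD // rpredZ.
Qed.

HB.instance Definition _ :=
  GRing.isSubmodClosed.Build R R^o add_principal add_principal_submod.
End AddPrincipal.
End Ideals.

(* Vectors (u_1, u_2, u_3) are functions on 'I_3, indexed from 0. *)
Definition i1 : 'I_3 := @Ordinal 3 0 isT.
Definition i2 : 'I_3 := @Ordinal 3 1 isT.
Definition i3 : 'I_3 := @Ordinal 3 2 isT.

Section HerzogNorthcott.
Variable k : fieldType.
Notation A := {mpoly k[3]}.
Notation x1 := ('X_i1 : A).
Notation x2 := ('X_i2 : A).
Notation x3 := ('X_i3 : A).

Definition HN_gens (a b : 'I_3 -> nat) : seq A :=
  let c i := (a i + b i)%N in
  [:: x1 ^+ c i1 - x2 ^+ b i2 * x3 ^+ a i3;
      x2 ^+ c i2 - x1 ^+ a i1 * x3 ^+ b i3;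
      x3 ^+ c i3 - x1 ^+ b i1 * x2 ^+ a i2].

Definition is_HN_ideal (I : {pred A}) : Prop :=
  exists a b : 'I_3 -> nat,
    (forall i, 0 < a i)%N /\ (forall i, 0 < b i)%N /\
    I =i gen_ideal (HN_gens a b).

Definition assoc_vec (I : ideal A) (i : 'I_3) : nat :=
  mod_length (quot_mod (add_principal 'X_i I)).

(* The kernel of the k-algebra morphism A -> k[t], x_i |-> t ^ n_i. *)
Definition herzog_ideal (n : 'I_3 -> nat) : {pred A} :=
  fun f => mmap (@polyC k) (fun i => 'X^(n i)) f == 0.
End HerzogNorthcott.

(* Main.v *)
From HB Require Import structures.
Require Import Defs.
From mathcomp Require Import all_boot all_order all_algebra.
From mathcomp Require Import boolp ssrcomplements mpoly bigenough zify ring.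

Set Implicit Arguments.
Unset Strict Implicit.
Unset Printing Implicit Defensive.

Import Order.TTheory GRing.Theory Num.Theory Quotient BigEnough.
Local Open Scope ring_scope.

(* For cyclic (p, q, r), x_p A + I is the monomial ideal generated by x_p,
   x_q^(b_q) x_r^(a_r), x_q^(c_q) and x_r^(c_r), so m_p(I) counts the monomials
   under a staircase. Thus m(I) is the cross product of the exponent vectors of
   v_1 and v_2. Let L be the lattice spanned by these; it lies in the kernel of
   m(I), with equality iff gcd(m(I)) = 1. Rewriting with the generators brings
   each monomial to a power of x_1 times a monomial under the first staircase,
   and distinct such normal forms are incongruent modulo L; so I contains
   x^u - x^v as soon as u - v lies in L. If gcd(m(I)) = 1, these binomials span
   the Herzog ideal of m(I). Otherwise a torsion element of Z^3/L gives a
   factorization in I, which the Z^3/L-grading shows to contradict primality. *)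

(** * Length of quotients by monomial ideals *)

Lemma mod_lengthE (R : pzRingType) (M : lmodType R) (n : nat) :
  has_length M n -> mod_length M = n.
Proof.
move=> [Mn Mle]; rewrite /mod_length; case: pselect => [h|[]]; last by exists n.
case: (cid h) => p [Mp Mple] /=; apply/eqP.
by rewrite eqn_leq Mle // Mple.
Qed.

Section MonomialLength.
Local Open Scope quotient_scope.
Variables (k : fieldType) (n : nat) (J : ideal {mpoly k[n]}) (S : seq 'X_{1..n}).
Hypothesis Suniq : uniq S.
Hypothesis Sdown : forall u v : 'X_{1..n}, (u + v)%MM \in S -> v \in S.
Hypothesis JS : forall f : {mpoly k[n]},
  f \in (J : {pred _}) <-> {in S, forall m, f@_m = 0}.

(** All coefficients on [S] vanish on [J], so they are coordinates on the quotient. *)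
Lemma repr_pi_mcoeff (f : {mpoly k[n]}) m :
  m \in S -> (repr (\pi_(quot_mod J) f))@_m = f@_m.
Proof.
move=> Sm; apply/eqP; rewrite -subr_eq0 -mcoeffB.
have /JS -> // : repr (\pi_(quot_mod J) f) - f \in (J : {pred _}).
have : repr (\pi_(quot_mod J) f) - f \in submod_pred J by rewrite idealrBE reprK.
by [].
Qed.

(* A chain C_0 < ... < C_p gives p elements, the i-th one in C_(i+1) but not in
   C_i; a linear relation between their coefficient vectors on S would put
   one of them in the smaller submodule. *)
Lemma monomial_chain_le p : submod_chain (quot_mod J) p -> (p <= size S)%N.
Proof.
move=> [C Cchain]; rewrite leqNgt; apply/negP => ltSp.
have Clt (i : 'I_p) : exists f : {mpoly k[n]},
    \pi_(quot_mod J) f \in C (lift ord0 i) /\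
    ~ \pi_(quot_mod J) f \in C (widen_ord (leqnSn p) i).
  have [|_ /existsNP[q /not_implyP[Cq nCq]]] :=
    Cchain (widen_ord (leqnSn p) i) (lift ord0 i); first by rewrite lift0.
  by exists (repr q); rewrite reprK.
have {Clt}[f fC] := choice Clt.
have Cmono (i j : 'I_p.+1) : (i <= j)%N -> {subset C i <= C j}.
  rewrite leq_eqVlt => /orP[/eqP/val_inj -> //|/Cchain[]//].
pose M := \matrix_(i < p, j < size S) (f i)@_(nth 0%MM S j).
have : kermx M != 0.
  rewrite kermx_eq0 /row_free; apply/eqP => rM.
  by have := rank_leq_col M; rewrite rM leqNgt ltSp.
case/rowV0Pn => c /sub_kermxP cM0 c_neq0.
have [i0 ci0] : exists i, c 0 i != 0.
  apply/existsP; apply: contraNT c_neq0 => /existsPn c0.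
  by apply/eqP/rowP => i; rewrite mxE; apply/eqP; have := c0 i; rewrite negbK.
(* With [i] the largest index of a nonzero coefficient, [f i] is modulo [J] a combination of the
   [f j] with [j < i], whose classes all lie in [C i]. *)
case: (@arg_maxnP _ i0 (fun i => c 0 i != 0) (fun i => nat_of_ord i) ci0) => i ci imax.
case: (fC i) => _; apply.
have fJ : \sum_j (c 0 j)%:MP * f j \in (J : {pred _}).
  apply/JS => m Sm; rewrite raddf_sum /=.
  have lt_m : (index m S < size S)%N by rewrite index_mem.
  move/matrixP/(_ 0 (Ordinal lt_m)): cM0; rewrite !mxE => E; apply: etrans E.
  by apply: eq_bigr => j _; rewrite mcoeffCM mxE nth_index.
have pif : \pi_(quot_mod J) (\sum_j (c 0 j)%:MP * f j) = 0.
  have -> : 0 = \pi_(quot_mod J) (0 : {mpoly k[n]}) by rewrite raddf0.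
  by apply/eqP; rewrite -idealrBE subr0.
rewrite raddf_sum /= (bigD1 i) //= in pif.
have piZ (d : k) (g : {mpoly k[n]}) :
    \pi_(quot_mod J) (d%:MP * g) = (d%:MP : {mpoly k[n]}) *: \pi_(quot_mod J) g.
  exact: (pi_scale J d%:MP g).
have -> : \pi_(quot_mod J) (f i) =
    ((c 0 i)^-1)%:MP *: \pi_(quot_mod J) ((c 0 i)%:MP * f i).
  by rewrite piZ scalerA -mpolyCM mulVf // scale1r.
apply: rpredZ.
move/eqP: pif; rewrite addr_eq0 => /eqP ->; rewrite -scaleN1r; apply: rpredZ.
apply: rpred_sum => j ji; rewrite piZ.
have [cj|cj] := eqVneq (c 0 j) 0; first by rewrite cj scale0r rpred0.
apply: rpredZ; apply: Cmono (proj1 (fC j)).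
by rewrite lift0 /= ltn_neqAle ji /=; apply: imax.
Qed.

(** List [S] by decreasing degree and let the i-th submodule be spanned by the first i monomials. It
    is stable, since multiplication by a nonconstant monomial raises the degree and so moves a
    monomial up the list or out of [S]. *)
Lemma monomial_chain : submod_chain (quot_mod J) (size S).
Proof.
pose e := sort (fun u v => (mdeg v <= mdeg u)%N) S.
have mem_e m : (m \in e) = (m \in S) by rewrite mem_sort.
have Esize : size e = size S by rewrite size_sort.
have piZ (a f : {mpoly k[n]}) : \pi_(quot_mod J) (a * f) = a *: \pi_(quot_mod J) f.
  exact: (pi_scale J a f).
have memC i : submod_closed (fun q : quot_mod J =>
    `[< forall m, m \in S -> (i <= index m e)%N -> (repr q)@_m = 0 >]).
  split.
    apply/asboolP => m Sm _.
    have -> : (0 : quot_mod J) = \pi_(quot_mod J) 0 by rewrite raddf0.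
    by rewrite repr_pi_mcoeff // mcoeff0.
  move=> a u v /asboolP u0 /asboolP v0; apply/asboolP => m Sm le_im.
  have -> : a *: u + v = \pi_(quot_mod J) (a * repr u + repr v).
    by rewrite raddfD /= piZ !reprK.
  rewrite repr_pi_mcoeff // mcoeffD v0 // addr0 mcoeffM big1 // => -[[x ?] [y ?]] /= /eqP mxy.
  have Sy : y \in S by apply: (@Sdown x); rewrite -mxy.
  rewrite u0 ?mulr0 //.
  (* If the divisor [y] of [m] came before [m], its degree would be at least that of [m], so [x]
     would be 0 and [y] equal to [m]. *)
  apply: leq_trans le_im _; rewrite leqNgt; apply/negP => lt_ym.
  have degT : transitive (fun u v : 'X_{1..n} => (mdeg v <= mdeg u)%N).
    by move=> ? ? ? /[swap]; apply: leq_trans.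
  have e_sorted : sorted (fun u v => (mdeg v <= mdeg u)%N) e.
    by apply: sort_sorted => ? ?; apply: leq_total.
  have := sorted_ltn_index degT e_sorted y m.
  rewrite !mem_e => /(_ Sy Sm lt_ym); rewrite {1}mxy mdegD.
  rewrite -[leqRHS]add0n leq_add2r leqn0 mdeg_eq0 => /eqP x0.
  by move: lt_ym; rewrite mxy x0 add0m ltnn.
pose C (i : 'I_(size S).+1) : submodClosed (quot_mod J) :=
  HB.pack (_ : {pred quot_mod J}) (GRing.isSubmodClosed.Build _ _ _ (memC i)).
exists C; move=> i j lt_ij; split=> [q /asboolP qi|].
  by apply/asboolP => m Sm le_jm; apply: qi => //; apply: leq_trans le_jm; apply: ltnW.
have lt_i : (i < size e)%N by rewrite Esize (leq_trans lt_ij) // -ltnS.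
(* Counting from 0, the i-th monomial of [e] lies in [C j] for [j > i] but not in [C i]. *)
pose m := nth 0%MM e i.
have Sm : m \in S by rewrite -mem_e mem_nth.
have im : index m e = i by rewrite index_uniq // sort_uniq.
move=> /(_ (\pi_(quot_mod J) 'X_[m])) Cm; suff: \pi_(quot_mod J) 'X_[m] \in C j.
  move=> /Cm /asboolP /(_ m Sm); rewrite im => /(_ (leqnn i)).
  by rewrite repr_pi_mcoeff // mcoeffX eqxx => /eqP; rewrite oner_eq0.
apply/asboolP => m' Sm' le_jm; rewrite repr_pi_mcoeff // mcoeffX.
by case: eqP le_jm => // <-; rewrite im leqNgt lt_ij.
Qed.

Lemma mod_length_monomial : mod_length (quot_mod J) = size S.
Proof.
by apply: mod_lengthE; split; [exact: monomial_chain | exact: monomial_chain_le].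
Qed.

End MonomialLength.

Section GenIdeal.
Variable R : comNzRingType.

Lemma mem_gen_ideal (s : seq R) (x : R) : x \in s -> x \in gen_ideal s.
Proof.
move=> sx; apply/asboolP; have lt_x : (index x s < size s)%N by rewrite index_mem.
exists (fun i => (i == Ordinal lt_x)%:R).
rewrite (bigD1 (Ordinal lt_x)) //= eqxx mul1r nth_index // big1 ?addr0 //.
by move=> i /negPf ->; rewrite mul0r.
Qed.

Lemma gen_ideal_sub (s : seq R) (K : ideal R) :
  (forall x, x \in s -> x \in (K : {pred R})) ->
  {subset gen_ideal s <= (K : {pred R})}.
Proof.
move=> sK x /asboolP[g ->]; apply: rpred_sum => i _.
by apply: (rpredZ (V := R^o)); apply: sK; rewrite mem_nth.
Qed.
End GenIdeal.

(** * Standard monomials of a monomial ideal *)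

Section MonomialIdeal.
Variables (k : fieldType) (n : nat).
Implicit Types (u m : 'X_{1..n}) (U : seq 'X_{1..n}).

Lemma mcoeffXM_notin u m (g : {mpoly k[n]}) : ~~ (u <= m)%MM -> (g * 'X_[u])@_m = 0.
Proof.
move=> um; apply/eqP; rewrite -[_ == 0]negbK -mcoeff_msupp.
rewrite (perm_mem (msuppMX _ _)).
by apply: contra um => /mapP[v _ ->]; apply/mnm_lepP => i; rewrite mnmDE leq_addr.
Qed.

(** A multiple of a generator involves only monomials divisible by it; conversely, each term
    divisible by a generator lies in the ideal. *)
Lemma monomial_idealP U (f : {mpoly k[n]}) :
  f \in gen_ideal [seq 'X_[u] : {mpoly k[n]} | u <- U] <->
  forall m, all (fun u => ~~ (u <= m)%MM) U -> f@_m = 0.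
Proof.
split=> [/asboolP[g ->] m /allP mU|f0].
  rewrite raddf_sum /= big1 // => i _.
  have lt_i : (i < size U)%N by rewrite -(size_map (fun u => 'X_[u] : {mpoly k[n]})).
  by rewrite (nth_map 0%MM) // mcoeffXM_notin // mU // mem_nth.
rewrite (mpolyE f); apply: rpred_sum => m _.
have [/f0 ->|/allPn[u Uu]] := boolP (all (fun u => ~~ (u <= m)%MM) U).
  by rewrite scale0r rpred0.
rewrite negbK => /submK <-; rewrite mpolyXD -mul_mpolyC mulrA.
apply: (rpredZ (V := {mpoly k[n]}^o)); apply: mem_gen_ideal.
exact: map_f.
Qed.

Lemma mod_length_monomial_ideal (J : ideal {mpoly k[n]}) U (S : seq 'X_{1..n}) :
  J =i gen_ideal [seq 'X_[u] : {mpoly k[n]} | u <- U] ->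
  uniq S -> (forall m, (m \in S) = all (fun u => ~~ (u <= m)%MM) U) ->
  mod_length (quot_mod J) = size S.
Proof.
move=> JU Suniq SU; apply: mod_length_monomial => // [u v|f].
  rewrite !SU => /allP uvU; apply/allP => w Uw.
  apply: contra (uvU w Uw) => /lepm_trans; apply.
  by apply/mnm_lepP => i; rewrite mnmDE leq_addl.
rewrite JU monomial_idealP; split=> f0 m; first by rewrite SU => /f0.
by rewrite -SU => /f0.
Qed.
End MonomialIdeal.

(** * Counting the monomials under a staircase *)

Section Staircase.
Variables (k : fieldType) (p q r : 'I_3).
Hypotheses (pq : p != q) (qr : q != r) (pr : p != r).

(** The standard monomials x_q^j x_r^l fill two rectangles: [l < al + de] for [j < be], and [l < al]
    for [be <= j < be + ga]. *)
Lemma mod_length_staircase (J : ideal {mpoly k[3]}) (al be ga de : nat) :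
  J =i gen_ideal [:: 'X_p : {mpoly k[3]}; 'X_q ^+ be * 'X_r ^+ al;
                     'X_q ^+ (be + ga); 'X_r ^+ (al + de)] ->
  mod_length (quot_mod J) = (be * (al + de) + ga * al)%N.
Proof.
pose mon j l : 'X_{1..3} := (U_(q) *+ j + U_(r) *+ l)%MM.
have Xmon j l : 'X_[mon j l] = 'X_q ^+ j * 'X_r ^+ l :> {mpoly k[3]}.
  by rewrite mpolyXD -!mpolyXn.
pose U : seq 'X_{1..3} := [:: U_(p)%MM; mon be al; mon (be + ga)%N 0%N; mon 0%N (al + de)%N].
have -> : [:: 'X_p : {mpoly k[3]}; 'X_q ^+ be * 'X_r ^+ al;
              'X_q ^+ (be + ga); 'X_r ^+ (al + de)] = [seq 'X_[u] | u <- U].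
  by rewrite /U /= !Xmon expr0 mulr1 mul1r.
move=> JU.
have monp j l : mon j l p = 0%N.
  by rewrite mnmDE !mulmnE !mnm1E [q == p]eq_sym [r == p]eq_sym (negPf pq) (negPf pr).
have monq j l : mon j l q = j.
  by rewrite mnmDE !mulmnE !mnm1E [r == q]eq_sym (negPf qr) eqxx mul1n addn0.
have monr j l : mon j l r = l.
  by rewrite mnmDE !mulmnE !mnm1E (negPf qr) eqxx mul1n.
(* Being distinct, [p], [q] and [r] exhaust ['I_3]. *)
have cover (P : 'I_3 -> Prop) : P p -> P q -> P r -> forall i, P i.
  move=> Pp Pq Pr i; suff /or3P[/eqP ->|/eqP ->|/eqP ->] : [|| i == p, i == q | i == r] by [].
  move: pq qr pr; rewrite -!val_eqE /=.
  by case: p q r i => [[|[|[|?]]] ?] [[|[|[|?]]] ?] [[|[|[|?]]] ?] [[|[|[|?]]] ?].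
have mon_inj : injective (fun x : nat * nat => mon x.1 x.2).
  by move=> [j l] [j' l'] /= /mnmP E; congr (_, _); [rewrite -(monq j l) E|rewrite -(monr j l) E].
pose D := [seq (j, l) | j <- iota 0 be, l <- iota 0 (al + de)] ++
          [seq (j, l) | j <- iota be ga, l <- iota 0 al].
rewrite (mod_length_monomial_ideal (S := [seq mon x.1 x.2 | x <- D]) JU).
- by rewrite size_map size_cat !size_allpairs !size_iota.
- rewrite map_inj_uniq // cat_uniq !allpairs_uniq ?iota_uniq //=; last 2 first.
  + by move=> [? ?] [? ?] _ _ [-> ->].
  + by move=> [? ?] [? ?] _ _ [-> ->].
  rewrite andbT; apply/hasPn => _ /allpairsP[[j l] /= [+ _ ->]].
  rewrite mem_iota => /andP[le_j _]; apply/negP => /allpairsP[[j' l'] /= [+ _ [E _]]].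
  by rewrite mem_iota -E /= ltnNge le_j.
move=> m.
have lepE j l : (mon j l <= m)%MM = (j <= m q)%N && (l <= m r)%N.
  apply/mnm_lepP/andP => [le_m|[le_j le_l]]; first by rewrite -(monq j l) -{2}(monr j l).
  by apply: cover; rewrite ?monp ?monq ?monr.
have lepp : (U_(p) <= m)%MM = (0 < m p)%N.
  apply/mnm_lepP/idP => [/(_ p)|lt0]; first by rewrite mnm1E eqxx.
  by apply: cover; rewrite mnm1E ?eqxx // ?(negPf pq) ?(negPf pr).
have -> : (m \in [seq mon x.1 x.2 | x <- D]) = (m p == 0%N) && ((m q, m r) \in D).
  apply/mapP/andP => [[x Dx ->]|[/eqP mp Dm]].
    by rewrite monp monq monr -surjective_pairing.
  exists (m q, m r) => //; apply/mnmP; apply: cover; by rewrite ?monp ?monq ?monr.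
rewrite /= !lepE lepp mem_cat.
have memD (j l j0 j1 l1 : nat) :
    ((j, l) \in [seq (j, l) | j <- iota j0 j1, l <- iota 0 l1]) =
    [&& (j0 <= j)%N, (j < j0 + j1)%N & (l < l1)%N].
  rewrite [RHS]andbA -mem_iota -[(l < l1)%N](mem_iota 0 l1 l).
  apply/allpairsP/andP => [[[x y] /= [sx ty [-> ->]]] //|[sx ty]].
  by exists (j, l).
rewrite !memD; lia.
Qed.
End Staircase.

(** * The lattice of a Herzog-Northcott ideal *)

Section Lattice.
Variables a1 a2 a3 b1 b2 b3 : nat.
Hypotheses (a1_gt0 : (0 < a1)%N) (a2_gt0 : (0 < a2)%N) (a3_gt0 : (0 < a3)%N).
Hypotheses (b1_gt0 : (0 < b1)%N) (b2_gt0 : (0 < b2)%N) (b3_gt0 : (0 < b3)%N).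
Let c1 := (a1 + b1)%N.
Let c2 := (a2 + b2)%N.
Let c3 := (a3 + b3)%N.
Let m1 := (b2 * c3 + a2 * a3)%N.
Let m2 := (b3 * c1 + a3 * a1)%N.
Let m3 := (b1 * c2 + a1 * a2)%N.

(* Spanned by the exponent vectors (c1, -b2, -a3) and (-a1, c2, -b3) of v1 and
   v2; the exponent vector of D is minus their sum. *)
Definition HN_lattice (x y z : int) : Prop := exists s t : int,
  [/\ x = s * c1%:Z - t * a1%:Z, y = t * c2%:Z - s * b2%:Z
    & z = - (s * a3%:Z) - t * b3%:Z].

Let m3_gt0 : (0 < m3)%N.
Proof. by rewrite addn_gt0 !muln_gt0 a1_gt0 a2_gt0 orbT. Qed.

(** The minor c1 c2 - a1 b2 of the two generators is [m3], which is positive. *)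
Lemma HN_lattice_indep (s t : int) :
  s * c1%:Z = t * a1%:Z -> t * c2%:Z = s * b2%:Z -> s = 0 /\ t = 0.
Proof.
move=> e1 e2.
have s0 : s * m3%:Z = 0.
  have -> : s * m3%:Z = c2%:Z * (s * c1%:Z) - a1%:Z * (s * b2%:Z).
    by rewrite /m3 /c1 /c2; lia.
  by rewrite e1 -e2; ring.
have t0 : t * m3%:Z = 0.
  have -> : t * m3%:Z = c1%:Z * (t * c2%:Z) - b2%:Z * (t * a1%:Z).
    by rewrite /m3 /c1 /c2; lia.
  by rewrite -e1 e2; ring.
have m3_neq0 : m3%:Z != 0 by rewrite eqz_nat -lt0n m3_gt0.
split; apply/eqP; [move/eqP: s0|move/eqP: t0];
  by rewrite mulf_eq0 (negPf m3_neq0) orbF.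
Qed.

Lemma HN_latticeD x y z x' y' z' : HN_lattice x y z -> HN_lattice x' y' z' ->
  HN_lattice (x + x') (y + y') (z + z').
Proof.
by move=> [s [t [-> -> ->]]] [s' [t' [-> -> ->]]]; exists (s + s'), (t + t'); split; ring.
Qed.

Lemma HN_latticeZ e x y z : HN_lattice x y z -> HN_lattice (e * x) (e * y) (e * z).
Proof.
by move=> [s [t [-> -> ->]]]; exists (e * s), (e * t); split; ring.
Qed.

(* Cramer's rule: since m is the cross product of the two generators w1, w2 of
   the lattice, det(p, w1, w2) d = det(p, d, w2) w1 + det(p, w1, d) w2 as soon
   as m . d = 0. *)
Lemma HN_lattice_bezout (p1 p2 p3 g x y z : int) :
  p1 * m1%:Z + p2 * m2%:Z + p3 * m3%:Z = g ->
  x * m1%:Z + y * m2%:Z + z * m3%:Z = 0 ->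
  HN_lattice (g * x) (g * y) (g * z).
Proof.
move=> <- d0.
exists (p1 * (- y * b3%:Z - z * c2%:Z) + p2 * (- z * a1%:Z + x * b3%:Z)
        + p3 * (x * c2%:Z + y * a1%:Z)).
exists (p1 * (- b2%:Z * z + a3%:Z * y) + p2 * (- a3%:Z * x - c1%:Z * z)
        + p3 * (c1%:Z * y + b2%:Z * x)).
(* Cramer's identity has a third term det(d, w1, w2) p = (m . d) p; once it is restored, each
   coordinate is a polynomial identity. *)
have E w w' p : w' = w - p * (x * m1%:Z + y * m2%:Z + z * m3%:Z) -> w = w'.
  by rewrite d0 mulr0 subr0.
split; [apply: (E _ _ p1)|apply: (E _ _ p2)|apply: (E _ _ p3)];
  by rewrite /m1 /m2 /m3 /c1 /c2 /c3 !(PoszD, PoszM); ring.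
Qed.

(** Let w1, w2 be the generators and m = g n. The vectors (n3, 0, -n1), (0, n3, -n2) and (n2, -n1,
    0) are orthogonal to m, hence in the lattice; expanding g times each of them in w1, w2 shows
    that g divides every entry of w1. Then w1 / g is in the lattice too, so g divides 1. *)
Lemma HN_lattice_saturated_gcd :
  (forall x y z : int, x * m1%:Z + y * m2%:Z + z * m3%:Z = 0 -> HN_lattice x y z) ->
  gcdn (gcdn m1 m2) m3 = 1%N.
Proof.
move=> sat; set g := gcdn _ _.
have [n1 Em1] : exists n, m1 = (n * g)%N.
  by apply/dvdnP; rewrite /g -gcdnA dvdn_gcdl.
have [n2 Em2] : exists n, m2 = (n * g)%N.
  by apply/dvdnP; rewrite /g gcdnAC dvdn_gcdr.
have [n3 Em3] : exists n, m3 = (n * g)%N by apply/dvdnP; rewrite /g dvdn_gcdr.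
(* By independence, the coefficients of g d are g times those of d when d is in the lattice. *)
have uniq_coef (x y z s t : int) : g%:Z * x = s * c1%:Z - t * a1%:Z ->
    g%:Z * y = t * c2%:Z - s * b2%:Z -> HN_lattice x y z ->
    (exists s', s = g%:Z * s') /\ (exists t', t = g%:Z * t').
  move=> ex ey [s' [t' [ex' ey' _]]]; rewrite ex' in ex; rewrite ey' in ey.
  have [||] := @HN_lattice_indep (s - g%:Z * s') (t - g%:Z * t').
  - rewrite !mulrBl; lia.
  - rewrite !mulrBl; lia.
  by move=> /eqP + /eqP; rewrite !subr_eq0 => /eqP -> /eqP ->; split; eexists.
(* Here g (n3, 0, -n1) = (m3, 0, -m1) = c2 w1 + b2 w2; the next two vectors are treated alike. *)
have [[c2' Ec2] [b2' Eb2]] : (exists e, c2%:Z = g%:Z * e) /\ (exists e, b2%:Z = g%:Z * e).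
  apply: (uniq_coef n3%:Z 0 (- n1%:Z)); [|ring|].
    by rewrite -[g%:Z * _]PoszM mulnC -Em3 /m3 /c1 /c2; lia.
  by apply: sat; rewrite Em1 Em3 Em2; lia.
have [[a1' Ea1] [c1' Ec1]] : (exists e, a1%:Z = g%:Z * e) /\ (exists e, c1%:Z = g%:Z * e).
  apply: (uniq_coef 0 n3%:Z (- n2%:Z)); [ring| |].
    by rewrite -[g%:Z * _]PoszM mulnC -Em3 /m3 /c1 /c2; lia.
  by apply: sat; rewrite Em1 Em3 Em2; lia.
have [[b3' Eb3] [a3' Ea3]] : (exists e, b3%:Z = g%:Z * e) /\ (exists e, - a3%:Z = g%:Z * e).
  apply: (uniq_coef n2%:Z (- n1%:Z) 0).
  - by rewrite -[g%:Z * _]PoszM mulnC -Em2 /m2 /c1; lia.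
  - by rewrite mulrN -[g%:Z * _]PoszM mulnC -Em1 /m1 /c2 /c3; lia.
  - by apply: sat; rewrite Em1 Em3 Em2; lia.
(* The vector w1 / g: its multiple by g has coefficients 1 and 0. *)
have [] := uniq_coef c1' (- b2') a3' 1 0.
- by rewrite -Ec1; ring.
- by rewrite mulrN -Eb2; ring.
- apply: sat; have g_neq0 : g%:Z != 0.
    by rewrite /g eqz_nat -lt0n gcdn_gt0 m3_gt0 orbT.
  apply: (mulfI g_neq0); rewrite mulr0 !mulrDr !mulrA mulrN -Ec1 -Eb2 -Ea3.
  by rewrite /m1 /m2 /m3 /c1 /c2 /c3; lia.
move=> [s' /(congr1 absz)]; rewrite abszM /= => /esym/eqP.
by rewrite muln_eq1 => /andP[/eqP].
Qed.

(** * Monomial congruences generated by the three binomials *)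

Section Congruence.
(** [E] abstracts congruence of monomials modulo I; [E1], [E2] and [E3] are the rewriting rules
    given by v1, v2 and D. *)
Variable E : nat -> nat -> nat -> nat -> nat -> nat -> Prop.
Hypothesis E_sym : forall x y z x' y' z', E x y z x' y' z' -> E x' y' z' x y z.
Hypothesis E_trans : forall x y z x' y' z' x'' y'' z'',
  E x y z x' y' z' -> E x' y' z' x'' y'' z'' -> E x y z x'' y'' z''.
Hypothesis E_refl : forall x y z, E x y z x y z.
Hypothesis E1 : forall x y z, E x (y + b2) (z + a3) (x + c1) y z.
Hypothesis E2 : forall x y z, E x (y + c2) z (x + a1) y (z + b3).
Hypothesis E3 : forall x y z, E x y (z + c3) (x + b1) (y + a2) z.

(* The monomials x2^y x3^z with [normal y z] are those outside
   (x2^b2 x3^a3, x2^c2, x3^c3), i.e. the basis of A/(x1 A + I). *)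
Let normal y z := [&& (y < c2)%N, (z < c3)%N & ~~ ((b2 <= y)%N && (a3 <= z)%N)].

(* Each rewriting step raises the exponent of x1 at constant m-weight, hence
   lowers m2 y + m3 z. *)
Lemma HN_normal_form x y z : exists x' y' z',
  [/\ normal y' z', E x y z x' y' z'
    & HN_lattice (x%:Z - x'%:Z) (y%:Z - y'%:Z) (z%:Z - z'%:Z)].
Proof.
have [w] := ubnP (m2 * y + m3 * z)%N; elim: w => // w IHw in x y z *.
rewrite ltnS => le_w.
have m1_gt0 : (0 < m1)%N by rewrite /m1 /c3; nia.
have e1 : (m2 * b2 + m3 * a3 = c1 * m1)%N by rewrite /m1 /m2 /m3 /c1 /c2 /c3; lia.
have e2 : (m2 * c2 = a1 * m1 + m3 * b3)%N by rewrite /m1 /m2 /m3 /c1 /c2 /c3; lia.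
have e3 : (m3 * c3 = b1 * m1 + m2 * a2)%N by rewrite /m1 /m2 /m3 /c1 /c2 /c3; lia.
have p1 : (0 < c1 * m1)%N by rewrite muln_gt0 addn_gt0 a1_gt0.
have p2 : (0 < a1 * m1)%N by rewrite muln_gt0 a1_gt0.
have p3 : (0 < b1 * m1)%N by rewrite muln_gt0 b1_gt0.
have step x1 y1 z1 : (m2 * y1 + m3 * z1 < m2 * y + m3 * z)%N -> E x y z x1 y1 z1 ->
    HN_lattice (x%:Z - x1%:Z) (y%:Z - y1%:Z) (z%:Z - z1%:Z) ->
    exists x' y' z', [/\ normal y' z', E x y z x' y' z'
      & HN_lattice (x%:Z - x'%:Z) (y%:Z - y'%:Z) (z%:Z - z'%:Z)].
  move=> lt1 e l; have [x' [y' [z' [N e' l']]]] := IHw x1 y1 z1 (leq_trans lt1 le_w).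
  exists x', y', z'; split=> //; first exact: E_trans e e'.
  by have := HN_latticeD l l'; rewrite !addrA !subrK.
have [yge|ylt] := leqP c2 y.
  rewrite -(subnK yge) in step *; apply: step (E2 _ _ _) _; first by rewrite !mulnDr; lia.
  by exists 0, 1; split; rewrite !PoszD; ring.
have [zge|zlt] := leqP c3 z.
  rewrite -(subnK zge) in step *; apply: step (E3 _ _ _) _; first by rewrite !mulnDr; lia.
  by exists (- 1), (- 1); split; rewrite /c1 /c2 /c3 !PoszD; ring.
have [/andP[yge zge]|N] := boolP ((b2 <= y)%N && (a3 <= z)%N); last first.
  exists x, y, z; split; [by rewrite /normal ylt zlt | exact: E_refl |].
  by exists 0, 0; split; ring.
rewrite -(subnK yge) -(subnK zge) in step *.
apply: step (E1 _ _ _) _; first by rewrite !mulnDr; lia.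
by exists (- 1), 0; split; rewrite !PoszD; ring.
Qed.

(** Write the difference as s w1 + t w2. If s and t are nonzero of the same sign, the third
    coordinate changes by at least c3; if t is nonzero and s is zero or of opposite sign, the second
    changes by at least c2; if only t is zero, one of the two points has [b2 <= y] and [a3 <= z]. *)
Lemma HN_normal_inj x y z x' y' z' : normal y z -> normal y' z' ->
  HN_lattice (x%:Z - x'%:Z) (y%:Z - y'%:Z) (z%:Z - z'%:Z) ->
  [/\ x = x', y = y' & z = z'].
Proof.
move=> /and3P[ylt zlt N] /and3P[ylt' zlt' N'] [s [t [ex ey ez]]].
suff [s0 t0] : s = 0 /\ t = 0 by rewrite s0 t0 in ex ey ez; split; lia.
have [s_ge0|s_lt0] := leP 0 s; have [t_ge0|t_lt0] := leP 0 t.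
- have [s0|s_gt0] : s = 0 \/ 1 <= s by lia.
    by split=> //; subst s; nia.
  have [t0|t_gt0] : t = 0 \/ 1 <= t by lia.
    by exfalso; subst t; nia.
  exfalso; have : 0 <= (s - 1) * a3%:Z by apply: mulr_ge0; lia.
  have : 0 <= (t - 1) * b3%:Z by apply: mulr_ge0; lia.
  rewrite /c3 in zlt zlt'; lia.
- by exfalso; nia.
- have [t0|t_gt0] : t = 0 \/ 1 <= t by lia.
    by exfalso; subst t; nia.
  by exfalso; nia.
- exfalso; have : 0 <= (- 1 - s) * a3%:Z by apply: mulr_ge0; lia.
  have : 0 <= (- 1 - t) * b3%:Z by apply: mulr_ge0; lia.
  rewrite /c3 in zlt zlt'; lia.
Qed.

(** The normal forms of the two monomials are congruent modulo the lattice, hence equal. *)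
Lemma HN_lattice_congr x y z x' y' z' :
  HN_lattice (x%:Z - x'%:Z) (y%:Z - y'%:Z) (z%:Z - z'%:Z) -> E x y z x' y' z'.
Proof.
have [u [v [w [N e l]]]] := HN_normal_form x y z.
have [u' [v' [w' [N' e' l']]]] := HN_normal_form x' y' z'.
move=> d.
have d' : HN_lattice (u%:Z - u'%:Z) (v%:Z - v'%:Z) (w%:Z - w'%:Z).
  have := HN_latticeD (HN_latticeD (HN_latticeZ (- 1) l) d) l'.
  by congr HN_lattice; ring.
have [? ? ?] := HN_normal_inj N N' d'; subst.
exact: E_trans e (E_sym e').
Qed.
End Congruence.
End Lattice.

(** * Herzog-Northcott ideals *)

Section CoeffSum.
Variables (k : fieldType) (n : nat) (P : pred 'X_{1..n}).
Implicit Types (f g : {mpoly k[n]}) (m u v : 'X_{1..n}).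

(** For [P] a class modulo the lattice, this is the value at (1, ..., 1) of a graded component; it
    serves to certify that a polynomial is not in I. *)
Definition coeff_sum f : k := \sum_(m <- msupp f | P m) f@_m.

(** A range independent of the support makes additivity termwise. *)
Lemma coeff_sumE f i : (msize f <= i)%N ->
  coeff_sum f = \sum_(m : 'X_{1..n < i} | P m) f@_m.
Proof.
move=> le_fi; pose T : subFinType _ := 'X_{1..n < i}.
rewrite /coeff_sum (big_mksub_cond T) ?msupp_uniq //=; last first.
  by move=> m /msize_mdeg_lt lt_m _; apply: leq_trans lt_m le_fi.
rewrite big_mkcondr /=; apply: eq_bigr => m _.
by case: ifPn => // /memN_msupp_eq0.
Qed.

Lemma coeff_sum_is_additive : additive coeff_sum.
Proof.
move=> f g; pose_big_enough i.
  rewrite !(@coeff_sumE _ i) // -sumrB.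
  by apply: eq_bigr => m _; rewrite mcoeffB.
by close.
Qed.

HB.instance Definition _ :=
  GRing.isAdditive.Build {mpoly k[n]} k coeff_sum coeff_sum_is_additive.

Lemma coeff_sumZX c m : coeff_sum (c *: 'X_[m]) = c * (P m)%:R.
Proof.
have [->|c0] := eqVneq c 0; first by rewrite scale0r raddf0 mul0r.
rewrite /coeff_sum (perm_big _ (msuppZ _ c0)) msuppX big_mkcond big_seq1.
by rewrite mcoeffZ mcoeffX eqxx; case: (P m); rewrite ?mulr1 ?mulr0.
Qed.

Lemma coeff_sumX m : coeff_sum 'X_[m] = (P m)%:R.
Proof. by rewrite -['X_[m]]scale1r coeff_sumZX mul1r. Qed.

(** In each monomial multiple of the binomial, the two terms are counted together and cancel. *)
Lemma coeff_sum_binomial g u v : (forall m, P (m + u)%MM = P (m + v)%MM) ->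
  coeff_sum (g * ('X_[u] - 'X_[v])) = 0.
Proof.
move=> Puv; rewrite (mpolyE g) mulr_suml raddf_sum big1_seq //= => m _.
by rewrite mulrBr -!scalerAl -!mpolyXD raddfB /= !coeff_sumZX Puv subrr.
Qed.
End CoeffSum.

Lemma mem_idealM (R : comNzRingType) (K : ideal R) (g x : R) :
  x \in (K : {pred R}) -> g * x \in (K : {pred R}).
Proof. exact: (rpredZ (V := R^o)). Qed.

(** This is the kernel of a ring morphism into the domain k[t]. *)
Lemma herzog_ideal_prime (k : fieldType) (n : 'I_3 -> nat) (I : {pred {mpoly k[3]}}) :
  I =i herzog_ideal n -> prime_ideal I.
Proof.
move=> In; pose phi := mmap (@polyC k) (fun i => 'X^(n i) : {poly k}).
have memI f : (f \in I) = (phi f == 0) by rewrite In.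
split; first split.
- by rewrite memI /phi raddf0.
- by rewrite memI /phi rmorph1 oner_eq0.
- move=> g u v; rewrite !memI => /eqP u0 /eqP v0.
  by rewrite /phi rmorphD rmorphM /= -/phi u0 v0 mulr0 addr0.
- by move=> u v; rewrite !memI /phi rmorphM mulf_eq0.
Qed.

Lemma big_gcdn3 (n : 'I_3 -> nat) :
  \big[gcdn/0%N]_(i < 3) n i = gcdn (gcdn (n i1) (n i2)) (n i3).
Proof.
rewrite !big_ord_recl big_ord0 gcdn0 gcdnA.
by congr (gcdn (gcdn _ _) _); congr (n _); apply: val_inj.
Qed.

Lemma gcdn3_bezout (n1 n2 n3 : nat) : exists p1 p2 p3 : int,
  p1 * n1%:Z + p2 * n2%:Z + p3 * n3%:Z = (gcdn (gcdn n1 n2) n3)%:Z.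
Proof.
have [u [v uv]] := Bezoutz n1 n2.
have [u' [v' <-]] : exists u' v', u' * gcdz n1 n2 + v' * n3%:Z = (gcdn (gcdn n1 n2) n3)%:Z.
  by have [u' [v' e]] := Bezoutz (gcdz n1 n2) n3; exists u', v'.
by exists (u' * u), (u' * v), v'; rewrite -uv; ring.
Qed.

(** * Associated vector, primality and Herzog ideal of an HN ideal *)

Section HN.
Variables (k : fieldType) (I : ideal {mpoly k[3]}) (a b : 'I_3 -> nat).
Hypotheses (a_gt0 : forall i, (0 < a i)%N) (b_gt0 : forall i, (0 < b i)%N).
Hypothesis Igen : I =i gen_ideal (HN_gens k a b).
Notation A := {mpoly k[3]}.

(* Locked, as comparing two of these binomials by conversion is very slow. *)
Definition HN_binom : 'I_3 -> 'I_3 -> 'I_3 -> A := locked (fun p q r =>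
  'X_p ^+ (a p + b p) - 'X_q ^+ (b q) * 'X_r ^+ (a r)).

Lemma HN_binomE p q r :
  HN_binom p q r = 'X_p ^+ (a p + b p) - 'X_q ^+ (b q) * 'X_r ^+ (a r).
Proof. by rewrite /HN_binom -lock. Qed.

(** The generators are cyclic shifts of one binomial, so one computation serves all three
    indices. *)
Lemma HN_gensE : HN_gens k a b = [:: HN_binom i1 i2 i3; HN_binom i2 i3 i1; HN_binom i3 i1 i2].
Proof. by rewrite /HN_gens !HN_binomE ['X_i3 ^+ b i3 * _]mulrC. Qed.

Lemma HN_binom_mem :
  [/\ HN_binom i1 i2 i3 \in (I : {pred A}), HN_binom i2 i3 i1 \in (I : {pred A})
    & HN_binom i3 i1 i2 \in (I : {pred A})].
Proof. by split; rewrite Igen mem_gen_ideal // HN_gensE !inE eqxx ?orbT. Qed.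

Lemma HN_sub (K : ideal A) :
  HN_binom i1 i2 i3 \in (K : {pred A}) -> HN_binom i2 i3 i1 \in (K : {pred A}) ->
  HN_binom i3 i1 i2 \in (K : {pred A}) -> {subset (I : {pred A}) <= (K : {pred A})}.
Proof.
move=> K1 K2 K3 f; rewrite Igen; apply: gen_ideal_sub => x.
by rewrite HN_gensE !inE => /or3P[] /eqP ->.
Qed.

(** Modulo x_p each binomial becomes a monomial up to sign, which gives a staircase ideal. The
    hypotheses on [I] say, in cyclic form, that the three binomials generate it. *)
Lemma assoc_vec_cyclic (p q r : 'I_3) : p != q -> q != r -> p != r ->
  HN_binom p q r \in (I : {pred A}) -> HN_binom q r p \in (I : {pred A}) ->
  HN_binom r p q \in (I : {pred A}) ->
  (forall K : ideal A,
    HN_binom p q r \in (K : {pred A}) -> HN_binom q r p \in (K : {pred A}) ->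
    HN_binom r p q \in (K : {pred A}) -> {subset (I : {pred A}) <= (K : {pred A})}) ->
  assoc_vec I p = (b q * (a r + b r) + a q * a r)%N.
Proof.
move=> pq qr pr Ip Iq Ir Isub.
rewrite /assoc_vec.
set G := [:: 'X_p : A; 'X_q ^+ (b q) * 'X_r ^+ (a r); 'X_q ^+ (b q + a q); 'X_r ^+ (a r + b r)].
apply: (mod_length_staircase pq qr pr (de := b r)).
rewrite -/G.
have powM (K : ideal A) e : (0 < e)%N -> 'X_p \in (K : {pred A}) ->
    'X_p ^+ e \in (K : {pred A}).
  by case: e => // e _ Kp; rewrite exprSr mem_idealM.
have mem i : (i < 4)%N -> G`_i \in gen_ideal G by move=> ?; rewrite mem_gen_ideal ?mem_nth.
have [[[G0 G1] G2] G3] := (mem 0%N isT, mem 1%N isT, mem 2%N isT, mem 3%N isT).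
rewrite /= in G0 G1 G2 G3.
move=> f; apply/idP/idP => [/asboolP[g If]|].
  rewrite -(subrK ('X_p * g) f); apply: rpredD; last by rewrite mulrC mem_idealM.
  apply: (Isub (gen_ideal G)) If; rewrite HN_binomE.
  - by apply: rpredB G1; apply: powM G0; rewrite addn_gt0 a_gt0.
  - rewrite addnC; apply: rpredB G2 _.
    by apply: mem_idealM; apply: powM G0.
  - apply: rpredB G3 _.
    by rewrite mulrC; apply: mem_idealM; apply: powM G0.
apply: (gen_ideal_sub (K := add_principal 'X_p I)).
have IJ : {subset (I : {pred A}) <= add_principal 'X_p I}.
  by move=> x Ix; apply/asboolP; exists 0; rewrite mulr0 subr0.
have Jp : 'X_p \in add_principal 'X_p I by apply/asboolP; exists 1; rewrite mulr1 subrr rpred0.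
have pos i : (0 < a i + b i)%N by rewrite addn_gt0 a_gt0.
move=> x; rewrite /G !inE => /or4P[] /eqP ->; first exact: Jp.
- rewrite -[X in X \in _](subKr ('X_p ^+ (a p + b p))) -HN_binomE.
  by apply: rpredB (IJ _ Ip); apply: powM Jp; apply: pos.
- rewrite addnC -(subrK ('X_r ^+ (b r) * 'X_p ^+ (a p)) ('X_q ^+ _)) -HN_binomE.
  by apply: rpredD (IJ _ Iq) _; apply: mem_idealM; apply: powM Jp.
- rewrite -(subrK ('X_p ^+ (b p) * 'X_q ^+ (a q)) ('X_r ^+ _)) -HN_binomE.
  by apply: rpredD (IJ _ Ir) _; rewrite mulrC; apply: mem_idealM; apply: powM Jp.
Qed.

Lemma assoc_vecE :
  [/\ assoc_vec I i1 = (b i2 * (a i3 + b i3) + a i2 * a i3)%N,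
      assoc_vec I i2 = (b i3 * (a i1 + b i1) + a i3 * a i1)%N
    & assoc_vec I i3 = (b i1 * (a i2 + b i2) + a i1 * a i2)%N].
Proof.
have [B1 B2 B3] := HN_binom_mem.
by split; apply: assoc_vec_cyclic => // K *; apply: HN_sub.
Qed.

Definition mono x y z : A := 'X_i1 ^+ x * 'X_i2 ^+ y * 'X_i3 ^+ z.

Lemma mpolyX_mono (m : 'X_{1..3}) : 'X_[m] = mono (m i1) (m i2) (m i3).
Proof.
rewrite mpolyXE_id !big_ord_recl big_ord0 mulr1 mulrA /mono.
by congr (_ * _ * _); congr ('X__ ^+ m _); apply: val_inj.
Qed.

(** Congruence modulo [I] is an equivalence, and its rewriting rules are monomial multiples of the
    generators up to sign. *)
Lemma mono_congr x y z x' y' z' :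
  HN_lattice (a i1) (a i2) (a i3) (b i1) (b i2) (b i3)
    (x%:Z - x'%:Z) (y%:Z - y'%:Z) (z%:Z - z'%:Z) ->
  mono x y z - mono x' y' z' \in (I : {pred A}).
Proof.
have [B1 B2 B3] := HN_binom_mem.
have memN (f : A) : f \in (I : {pred A}) -> - f \in (I : {pred A}).
  by rewrite -mulN1r; apply: mem_idealM.
have a0 := a_gt0; have b0 := b_gt0.
apply: (HN_lattice_congr (a0 i1) (a0 i2) (a0 i3) (b0 i1) (b0 i2) (b0 i3)
  (E := fun x y z x' y' z' => mono x y z - mono x' y' z' \in (I : {pred A}))).
- by move=> *; rewrite -opprB; apply: memN.
- move=> u v w u' v' w' u'' v'' w'' e e'.
  by rewrite -(subrKA (mono u' v' w')); apply: rpredD.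
- by move=> *; rewrite subrr; apply: (rpred0 I).
- move=> u v w; have -> : mono u (v + b i2) (w + a i3) - mono (u + (a i1 + b i1)) v w =
      - mono u v w * HN_binom i1 i2 i3 by rewrite /mono !HN_binomE !exprD; ring.
  exact: mem_idealM.
- move=> u v w; have -> : mono u (v + (a i2 + b i2)) w - mono (u + a i1) v (w + b i3) =
      mono u v w * HN_binom i2 i3 i1 by rewrite /mono !HN_binomE !exprD; ring.
  exact: mem_idealM.
- move=> u v w; have -> : mono u v (w + (a i3 + b i3)) - mono (u + b i1) (v + a i2) w =
      mono u v w * HN_binom i3 i1 i2 by rewrite /mono !HN_binomE !exprD; ring.
  exact: mem_idealM.
Qed.

Definition mlattice (u v : 'X_{1..3}) :=
  HN_lattice (a i1) (a i2) (a i3) (b i1) (b i2) (b i3)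
    ((u i1)%:Z - (v i1)%:Z) ((u i2)%:Z - (v i2)%:Z) ((u i3)%:Z - (v i3)%:Z).

Lemma mpolyX_congr u v : mlattice u v -> 'X_[u] - 'X_[v] \in (I : {pred A}).
Proof. by rewrite !mpolyX_mono; apply: mono_congr. Qed.

Lemma mlattice_addl m u v w : mlattice u v -> mlattice (m + u)%MM w <-> mlattice (m + v)%MM w.
Proof.
rewrite /mlattice !mnmDE !PoszD => uv; split=> h.
  have := HN_latticeD h (HN_latticeZ (- 1) uv).
  by congr HN_lattice; ring.
by have := HN_latticeD h uv; congr HN_lattice; ring.
Qed.

(** Each generator is a difference of two monomials congruent modulo the lattice. *)
Lemma coeff_sum_HN (w : 'X_{1..3}) (f : A) : f \in (I : {pred A}) ->
  coeff_sum (fun m => `[< mlattice m w >]) f = 0.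
Proof.
have binom0 g p q r :
    mlattice (U_(p) *+ (a p + b p)) (U_(q) *+ b q + U_(r) *+ a r)%MM ->
    coeff_sum (fun m => `[< mlattice m w >]) (g * HN_binom p q r) = 0.
  rewrite !HN_binomE !mpolyXn -mpolyXD => l; apply: coeff_sum_binomial => m.
  by apply: asbool_equiv_eq; apply: mlattice_addl.
rewrite Igen HN_gensE => /asboolP[g ->]; rewrite !big_ord_recl big_ord0 /= addr0.
rewrite !raddfD /= !binom0 ?addr0 //; rewrite /mlattice !(mnmDE, mulmnE, mnm1E) /=.
- by exists (- 1), (- 1); split; lia.
- by exists 0, 1; split; lia.
- by exists 1, 0; split; lia.
Qed.

(* If m . d = 0 with d outside the lattice, of order r modulo it, write
   d = u - v: then x^(ru) - x^(rv) lies in I and is the product of x^u - x^v and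
   a sum of r monomials in distinct classes. Neither factor lies in I, as a
   single class of each has coefficient sum 1. *)
Lemma HN_prime_gcd : prime_ideal (I : {pred A}) ->
  gcdn (gcdn (assoc_vec I i1) (assoc_vec I i2)) (assoc_vec I i3) = 1%N.
Proof.
move=> [_ Iprime]; have [-> -> ->] := assoc_vecE.
apply: HN_lattice_saturated_gcd => // x y z xyz0; apply: contrapT => nL.
pose mult (r : nat) := `[< HN_lattice (a i1) (a i2) (a i3) (b i1) (b i2) (b i3)
  (r%:Z * x) (r%:Z * y) (r%:Z * z) >].
have [r /andP[r_gt0 rL] r_min] : exists2 r, (0 < r)%N && mult r &
    forall i, (0 < i)%N && mult i -> (r <= i)%N.
  have ex : exists r, (0 < r)%N && mult r.
    (* The order is finite: by Cramer's rule, gcd(m(I)) times d lies in the lattice. *)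
    have [p1 [p2 [p3 pm]]] := gcdn3_bezout (assoc_vec I i1) (assoc_vec I i2) (assoc_vec I i3).
    exists (gcdn (gcdn (assoc_vec I i1) (assoc_vec I i2)) (assoc_vec I i3)).
    have [e1 e2 e3] := assoc_vecE; rewrite e1 e2 e3 in pm *.
    apply/andP; split; last by apply/asboolP; apply: (HN_lattice_bezout pm xyz0).
    by rewrite !gcdn_gt0 !addn_gt0 !muln_gt0 !addn_gt0 !a_gt0 !b_gt0.
  by case: (ex_minnP ex) => r; exists r.
have natB (e : int) : exists u v : nat, e = u%:Z - v%:Z.
  by case: e => n; [exists n, 0%N; rewrite subr0 | exists 0%N, n.+1; rewrite sub0r NegzE].
pose mnm3 e1 e2 e3 : 'X_{1..3} := (U_(i1) *+ e1 + U_(i2) *+ e2 + U_(i3) *+ e3)%MM.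
have [u [v [Ex Ey Ez]]] : exists u v : 'X_{1..3},
    [/\ x = (u i1)%:Z - (v i1)%:Z, y = (u i2)%:Z - (v i2)%:Z & z = (u i3)%:Z - (v i3)%:Z].
  have [[x1 [x2 ->]] [y1 [y2 ->]] [z1 [z2 ->]]] := And3 (natB x) (natB y) (natB z).
  exists (mnm3 x1 y1 z1), (mnm3 x2 y2 z2).
  by rewrite /mnm3 !(mnmDE, mulmnE, mnm1E) /=; split; lia.
have : 'X_[u *+ r] - 'X_[v *+ r] \in (I : {pred A}).
  apply: mpolyX_congr; move/asboolP: rL; rewrite /mlattice !mulmnE Ex Ey Ez.
  by congr HN_lattice; rewrite !PoszM; ring.
rewrite -!mpolyXn subrXX => /Iprime /orP[|] /coeff_sum_HN.
(* In the class of [u] only x^u is counted, because d is not in the lattice. *)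
- move=> /(_ u); rewrite raddfB /= !coeff_sumX asboolT; last first.
    by exists 0, 0; rewrite !subrr; split; ring.
  rewrite asboolF; first by move/eqP; rewrite subr0 oner_eq0.
  move=> /(HN_latticeZ (- 1)) vu; apply: nL; move: vu; rewrite Ex Ey Ez.
  by congr HN_lattice; ring.
(* The i-th exponent (r-1-i) u + i v is congruent to (r-1) u only if i d is in the lattice;
   minimality of [r] leaves i = 0. *)
move=> /(_ (u *+ r.-1)%MM).
rewrite raddf_sum /= (bigD1 (Ordinal r_gt0)) //= big1 => [|i i_neq0].
  rewrite subn0 expr0 mulr1 mpolyXn coeff_sumX asboolT ?addr0 => [/eqP|].
    by rewrite oner_eq0.
  by exists 0, 0; rewrite !subrr; split; ring.
rewrite !mpolyXn -mpolyXD coeff_sumX asboolF // => /(HN_latticeZ (- 1)) iL.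
have i_gt0 : (0 < i)%N by rewrite lt0n.
have := r_min i; rewrite i_gt0 leqNgt ltn_ord /= => /(_ _)/negP; apply => //.
apply/asboolP; move: iL; rewrite !(mnmDE, mulmnE) Ex Ey Ez.
have le_i : (i <= r.-1)%N by rewrite -ltnS prednK.
by congr HN_lattice; rewrite !(PoszD, PoszM) -subzn //; ring.
Qed.

(** With gcd 1, monomials of equal weight are congruent modulo [I]. Hence f is congruent to the sum
    over d of the coefficient of t^d in [phi f] times a representative of weight d, and this sum is
    zero on the kernel. *)
Lemma HN_gcd_herzog :
  gcdn (gcdn (assoc_vec I i1) (assoc_vec I i2)) (assoc_vec I i3) = 1%N ->
  I =i herzog_ideal (assoc_vec I).
Proof.
move: (assoc_vec I) assoc_vecE => n [e1 e2 e3] gcd1.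
pose phi := mmap (@polyC k) (fun i => 'X^(n i) : {poly k}).
pose wt (m : 'X_{1..3}) := (m i1 * n i1 + m i2 * n i2 + m i3 * n i3)%N.
have phiX m : phi 'X_[m] = 'X^(wt m).
  rewrite /phi mmapX /mmap1 !big_ord_recl big_ord0 mulr1 -!exprM -!exprD /wt.
  rewrite -addnA; congr ('X^(_ + (_ + _))); rewrite mulnC;
    by congr (m _ * n _)%N; apply: val_inj.
move=> f; apply/idP/idP => [|phif0].
  have phi0 g p q r : (n p * (a p + b p) = n q * b q + n r * a r)%N ->
      phi (g * HN_binom p q r) = 0.
    move=> E; rewrite /phi HN_binomE rmorphM rmorphB rmorphM !rmorphXn /= !mmapX !mmap1U.
    by rewrite -!exprM -exprD E subrr mulr0.
  rewrite Igen HN_gensE => /asboolP[g ->].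
  rewrite !big_ord_recl big_ord0 /= addr0 /herzog_ideal unfold_in !raddfD /=.
  by rewrite -![mmap _ _ _]/(phi _) !phi0 ?addr0 // e1 e2 e3; lia.
have wt_congr u v : wt u = wt v -> 'X_[u] - 'X_[v] \in (I : {pred A}).
  have [p1 [p2 [p3]]] := gcdn3_bezout (n i1) (n i2) (n i3).
  rewrite gcd1 => pn uv; apply: mpolyX_congr; rewrite /mlattice.
  rewrite -[_ - _]mul1r -[X in HN_lattice _ _ _ _ _ _ _ X]mul1r.
  rewrite -[X in HN_lattice _ _ _ _ _ _ _ _ X]mul1r.
  rewrite e1 e2 e3 in pn; apply: HN_lattice_bezout pn _.
  by rewrite -e1 -e2 -e3; move: uv; rewrite /wt; lia.
(* [rep d] represents all monomials of weight d modulo [I]; it is unconstrained if there are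
   none. *)
have [rep repP] : exists rep : nat -> A, forall m, 'X_[m] - rep (wt m) \in (I : {pred A}).
  have exrep d : exists g : A, forall m, wt m = d -> 'X_[m] - g \in (I : {pred A}).
    have [[m <-]|nm] := pselect (exists m, wt m = d).
      by exists 'X_[m] => m' /wt_congr.
    by exists 0 => m md; case: nm; exists m.
  have [rep repP] := choice exrep.
  by exists rep => m; apply: repP.
pose N := (\max_(m <- msupp f) wt m).+1.
have wtN m : m \in msupp f -> (wt m < N)%N.
  by move=> fm; rewrite ltnS; apply: leq_bigmax_seq.
(* Grouping the terms by weight, the coefficient of [rep d] is that of t^d in [phi f]. *)
have rep0 : \sum_(m <- msupp f) f@_m *: rep (wt m) = 0.
  transitivity (\sum_(d < N) (phi f)`_d *: rep d); last first.
    by rewrite big1 // => d _; move/eqP: phif0; rewrite -/phi => ->; rewrite coef0 scale0r.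
  transitivity (\sum_(m <- msupp f) \sum_(d < N) (f@_m * (d == wt m :> nat)%:R) *: rep d).
    rewrite big_seq [RHS]big_seq; apply: eq_bigr => m /wtN lt_m.
    rewrite (bigD1 (Ordinal lt_m)) //= eqxx mulr1 big1 ?addr0 // => d.
    by rewrite -val_eqE /= => /negPf ->; rewrite mulr0 scale0r.
  rewrite exchange_big; apply: eq_bigr => d _ /=.
  rewrite -scaler_suml; congr (_ *: _).
  rewrite /phi [in RHS](mpolyE f) raddf_sum coef_sum; apply: eq_bigr => m _ /=.
  by rewrite mmapZ -/(phi _) phiX /= coefCM coefXn.
suff : f - \sum_(m <- msupp f) f@_m *: rep (wt m) \in (I : {pred A}).
  by rewrite rep0 subr0.
rewrite [X in X - _](mpolyE f) -sumrB.
apply: rpred_sum => m _.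
have -> : f@_m *: 'X_[m] - f@_m *: rep (wt m) = (f@_m)%:MP * ('X_[m] - rep (wt m)).
  by rewrite mulrBr !mul_mpolyC.
exact: mem_idealM.
Qed.

End HN.

Theorem theorem7p8 (k : fieldType) (I : ideal {mpoly k[3]}) :
  is_HN_ideal I ->
  [<-> @prime_ideal {mpoly k[3]} I;
       I =i herzog_ideal (assoc_vec I);
       \big[gcdn/0%N]_(i < 3) assoc_vec I i = 1%N].
Proof.
move=> [a [b [a_gt0 [b_gt0 Igen]]]].
rewrite big_gcdn3.
have prime_gcd := HN_prime_gcd a_gt0 b_gt0 Igen.
have gcd_herzog := HN_gcd_herzog a_gt0 b_gt0 Igen.
(* The cycle is composed from: prime implies gcd 1, which implies Herzog, which implies prime. *)
tfae.
- by move=> /prime_gcd/gcd_herzog.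
- by move=> /herzog_ideal_prime/prime_gcd.
- by move=> /gcd_herzog/herzog_ideal_prime.
Qed.
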